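(* The graph $G_5$ has no (Borel) coloring $\mathbb{T}$-base with measure $4/25$.
   Context: $G_5$ is the graph with vertex set $\mathbb{Z}_5^2$ in which two vertices $(i,j)$ and $(i',j')$ are adjacent iff $i'-i\in\{2,3\}$ or $j'-j\in\{2,3\}$ (calculations modulo five). $\mathbb{T}=\mathbb{R}/\mathbb{Z}$ is equipped with its Haar (Lebesgue) probability measure. A set $A\subseteq \mathbb{T}$ is a coloring $\mathbb{T}$-base for a graph $G$ if there exists a function $f:V(G)\to \mathbb{T}$ such that $A+f(u)$ and $A+f(v)$ are disjoint for every edge $uv$ of $G$. *)

(* Defs.v *)
From HB Require Import structures.
From mathcomp Require Import all_boot all_order all_algebra ring_quotient.
From mathcomp Require Import all_classical all_reals all_analysis.
From mathcomp Require Import measurable_realfun.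
Import Order.TTheory GRing.Theory Num.Theory.
Import numFieldNormedType.Exports.

Set Implicit Arguments.
Unset Strict Implicit.
Unset Printing Implicit Defensive.

Local Open Scope classical_set_scope.
Local Open Scope ring_scope.
Local Open Scope quotient_scope.

Definition ints (R : realType) : zmodClosed R :=
  GRing.ZmodClosed.clone R (@Num.int_num_subdef R) _.

(* R / Z, with the quotient group structure and the quotient topology. *)
Definition circle (R : realType) : Type :=
  quotient_topology (Quotient.quot (ints R)).

HB.instance Definition _ (R : realType) := PointedTopological.copy (circle R)
  (quotient_topology (Quotient.quot (ints R))).
HB.instance Definition _ (R : realType) := Quotient.copy (circle R)
  (quotient_topology (Quotient.quot (ints R))).
HB.instance Definition _ (R : realType) := GRing.isZmodule.Build (circle R)
  (@Quotient.addqA R (ints R)) (@Quotient.addqC R (ints R))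
  (@Quotient.add0q R (ints R)) (@Quotient.addNq R (ints R)).

HB.instance Definition _ (R : realType) :=
  @isMeasurable.Build (sigma_display (@open (circle R))) (circle R)
    <<s @open (circle R) >> (@sigma_algebra0 _ setT _)
    (@sigma_algebraC _ _) (@sigma_algebra_bigcup _ setT _).

Definition circle_pi (R : realType) : measurableTypeR R -> circle R :=
  \pi_(circle R).

Lemma circle_piD (R : realType) (x y : R) :
  circle_pi (x + y) = (circle_pi x : circle R) + circle_pi y.
Proof. exact: Quotient.pi_add. Qed.

Lemma circle_pi_eq (R : realType) (x y : R) :
  (circle_pi x = circle_pi y :> circle R) <-> (x - y \is a Num.int).
Proof.
have -> : (x - y \is a Num.int) = (x == y %[mod Quotient.quot (ints R)]).
  exact: Quotient.idealrBE.
by split=> [xy|/eqP//]; apply/eqP; exact: xy.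
Qed.

Lemma measurable_circle_pi (R : realType) :
  measurable_fun [set: measurableTypeR R] (@circle_pi R).
Proof.
apply: (@measurability _ _ (measurableTypeR R) (circle R) setT
  (@circle_pi R) (@open (circle R))) => //.
move=> _ [B oB <-]; rewrite setTI.
exact: (open_measurable (A := (@circle_pi R @^-1` B))).
Qed.

(* Lebesgue measure on the fundamental domain [0, 1[, pushed to R / Z; it is a
   translation-invariant probability measure (haar_translation). *)
Definition haar (R : realType) : set (circle R) -> \bar R :=
  pushforward
    (mrestr (@lebesgue_measure R) (measurable_itv `[0%R, 1%R[)) (@circle_pi R).

Section haar_probability.
Context (R : realType).
Local Open Scope ereal_scope.

Let haar0 : haar set0 = 0 :> \bar R.
Proof. by rewrite /haar /pushforward preimage_set0 measure0. Qed.

Let haar_ge0 (A : set (circle R)) : 0 <= haar A.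
Proof. by rewrite /haar /pushforward; exact: measure_ge0. Qed.

Let haar_sigma_additive : semi_sigma_additive (@haar R).
Proof.
apply: measure_semi_sigma_additive; exact: measurable_circle_pi.
Qed.

HB.instance Definition _ := isMeasure.Build _ _ _ (@haar R)
  haar0 haar_ge0 haar_sigma_additive.

Let haarT : haar [set: circle R] = 1.
Proof.
rewrite /haar /pushforward preimage_setT /mrestr setTI.
by rewrite lebesgue_measure_itv/= lte_fin ltr01 oppr0 adde0.
Qed.

HB.instance Definition _ := Measure_isProbability.Build _ _ _ (@haar R) haarT.

End haar_probability.

Section haar_translation.
Context (R : realType).
Local Notation mu := (@lebesgue_measure R).
Local Notation shift t := (fun x : measurableTypeR R => x + t : measurableTypeR R).

Let measurable_shift t : measurable_fun [set: measurableTypeR R] (shift t).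
Proof. exact: measurable_funD. Qed.

Let mu_shift t (A : set R) : measurable A -> mu (shift t @^-1` A) = mu A.
Proof.
move=> mA; pose m : {measure set (measurableTypeR R) -> \bar R} :=
  measure_function_pushforward__canonical__measure_function_Measure mu
    (measurable_shift t).
suff -> : mu A = m A by [].
apply: lebesgue_measure_unique => //= _ [[a b]] _ <-.
rewrite /m/= /pushforward.
rewrite (_ : shift t @^-1` _ = `](a - t), (b - t)]%classic); last first.
  by apply/seteqP; split=> x /=; rewrite !in_itv/= ltrBlDr lerBrDr.
rewrite !lebesgue_measure_itv/= !lte_fin ltrD2r.
by case: ifP => // _; congr (_%:E); rewrite opprB addrA subrK.
Qed.

Lemma haar_translation (A : set (circle R)) (t : circle R) : measurable A ->
  haar [set a + t | a in A] = haar A.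
Proof.
move=> mA; pose P : set R := @circle_pi R @^-1` A.
have mP : measurable P.
  by rewrite -[P]setTI; exact: (measurable_circle_pi measurableT mA).
have [s s01 st] : exists2 s : R, 0 <= s < 1 & circle_pi s = t.
  exists (repr t - (Num.floor (repr t))%:~R).
    by rewrite subr_ge0 floor_le ltrBlDl -[ltRHS]intrD1 floorD1_gt.
  transitivity (circle_pi (repr t) : circle R); last exact: reprK.
  by apply/circle_pi_eq; rewrite addrAC subrr add0r rpredN intr_int.
have P1 x : P (x + 1) = P x.
  rewrite /P/= (_ : circle_pi (x + 1) = circle_pi x)//.
  by apply/circle_pi_eq; rewrite addrAC subrr add0r int_num1.
have {1}-> : haar [set a + t | a in A] = mu (shift (- s) @^-1` P `&` `[0, 1[).
  rewrite /haar /pushforward /mrestr; congr (mu (_ `&` _)).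
  apply/seteqP; split=> x /=.
    move=> [a Aa ax]; rewrite /P /= (_ : circle_pi (x - s) = a)//.
    by apply: (addIr t); rewrite ax -st -circle_piD subrK.
  by move=> Px; exists (circle_pi (x - s)) => //; rewrite -st -circle_piD subrK.
have mI (i : interval R) : measurable [set` i] by exact: measurable_itv.
have -> : shift (- s) @^-1` P `&` `[0, 1[ =
    shift (- s) @^-1` (P `&` `[- s, 1 - s[).
  by rewrite preimage_setI; congr (_ `&` _); apply/seteqP; split=> x /=;
    rewrite !in_itv/= lerBrDr addNr ltrBlDr subrK.
rewrite mu_shift; last exact: measurableI.
have split2 (a b c : R) : a <= b -> b <= c ->
    mu (P `&` `[a, c[) = (mu (P `&` `[a, b[) + mu (P `&` `[b, c[))%E.
  move=> ab bc; rewrite -measureU; [|exact: measurableI|exact: measurableI|].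
    by rewrite -setIUr -itv_bndbnd_setU.
  apply/seteqP; split=> x //= [[_ +] [_ +]]; rewrite !in_itv/=.
  by move=> /andP[_ xb] /andP[bx _]; move: (lt_le_trans xb bx); rewrite ltxx.
case/andP: s01 => s0 /ltW s1.
rewrite /haar /pushforward /mrestr.
rewrite (split2 (- s) 0 (1 - s)) ?oppr_le0 ?subr_ge0//.
rewrite (split2 0 (1 - s) 1) ?subr_ge0 ?gerBl// addeC; congr (_ + _)%E.
rewrite -(mu_shift 1 (A := P `&` `[1 - s, 1[)); last exact: measurableI.
congr (mu _); rewrite preimage_setI; congr (_ `&` _).
  by apply/funext => x; rewrite /preimage/= P1.
by apply/seteqP; split=> x /=;
  rewrite !in_itv/= [x + 1]addrC lerD2l gtrDl.
Qed.

End haar_translation.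

Definition coloring_base (R : realType) (V : Type) (adj : rel V)
    (A : set (circle R)) : Prop :=
  exists f : V -> circle R, forall u v, adj u v ->
    [set a + f u | a in A] `&` [set a + f v | a in A] = set0.

Definition G5 : rel ('Z_5 * 'Z_5) := fun u v =>
  (v.1 - u.1 \in [:: 2%:R; 3%:R]) || (v.2 - u.2 \in [:: 2%:R; 3%:R]).

(* Main.v *)
Require Import Defs.
From mathcomp Require Import all_boot all_order all_algebra.
From mathcomp Require Import all_classical all_reals all_analysis.
From mathcomp Require Import measurable_realfun ring lra.
Import Order.TTheory GRing.Theory Num.Theory.
Import numFieldNormedType.Exports.
Local Open Scope classical_set_scope.
Local Open Scope ring_scope.

(** For a color x let S(x) be the set of the vertices u with x in A + f(u). It is
independent, so it lies in a 2 x 2 square c + {0,1}^2; since the sets A + f(u)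
have total measure 25 * 4/25 = 4, almost every S(x) is a whole square.

Fix a in A. The squares S(a + f(u)) contain u, and S(a + f(u)), S(a + f(w)) are
disjoint when u, w are adjacent: a common t would put both u and w into
S(a + f(u) + f(w) - f(t)). Two squares are disjoint exactly when their corners
are adjacent, so the corner map is an endomorphism of G_5 moving every u into
u - {0,1}^2, which forces it to be a translation. Hence, with
d1 = f(0,0) - f(1,0) and d2 = f(0,0) - f(0,1), the corner of S(x + a d1 + b d2)
is that of S(x) minus (a,b).

By Dirichlet's theorem there are coprime a, b with a d1 + b d2 arbitrarily small
(this is where T being one-dimensional enters), so by Steinhaus' theorem some x and
x + a d1 + b d2 have the same square, although (a,b) is nonzero modulo 5. *)

(** * Squares and independent sets of $G_5$ *)

Definition square (c : 'Z_5 * 'Z_5) : {set 'Z_5 * 'Z_5} :=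
  [set u | (u.1 - c.1 \in [:: 0; 1]) && (u.2 - c.2 \in [:: 0; 1])]%SET.

Lemma in_square c u : (u \in square c) =
  (u.1 - c.1 \in [:: 0; 1]) && (u.2 - c.2 \in [:: 0; 1]).
Proof. by rewrite inE. Qed.

Lemma square_shift d c u : (u + d \in square (c + d)) = (u \in square c).
Proof. have E (a b e : 'Z_5) : a + e - (b + e) = a - b.
  by rewrite opprD addrACA subrr addr0.
by rewrite !in_square -(E u.1 c.1 d.1) -(E u.2 c.2 d.2). Qed.

Lemma card_square c : #|square c| = 4%N.
Proof.
have -> : square c = finset.setX [set c.1; c.1 + 1]%SET [set c.2; c.2 + 1]%SET.
  by apply/finset.setP => u; rewrite !inE !subr_eq !add0r ![1 + _]addrC.
have neq (a : 'Z_5) : (a != a + 1) by rewrite eq_sym addrC -subr_eq0 addrK.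
by rewrite cardsX !cards2 !neq.
Qed.

(** Here [j - i] is 0, 1 or -1, so {i, i+1} and {j, j+1} share [i + 1] if [j = i + 1], and [i]
    otherwise. *)
Lemma Z5_meet (i j : 'Z_5) : j - i \notin [:: 2%:R; 3%:R] ->
  exists k : 'Z_5, (k - i \in [:: 0; 1]) && (k - j \in [:: 0; 1]).
Proof.
have jE : j = i + (j - i) by rewrite addrC subrK.
move: (j - i) jE => d -> ndE; exists (if d == 1 then i + 1 else i).
case: ifPn => [/eqP ->|d1]; first by rewrite subrr [i + 1]addrC addrK.
rewrite subrr opprD addrA subrr add0r.
by case: d ndE d1 => [[|[|[|[|[|]]]]] //= ?].
Qed.

Lemma square_meet c c' : ~~ G5 c c' ->
  exists u, (u \in square c) && (u \in square c').
Proof.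
rewrite negb_or => /andP[/Z5_meet[i /andP[i1 i2]] /Z5_meet[j /andP[j1 j2]]].
by exists (i, j); rewrite !in_square /= i1 i2 j1 j2.
Qed.

(** Since [i - 1] and [i + 1] differ by 2, at most one of them accompanies [i] in [B]; this decides
    on which side of [i] the pair lies. *)
Lemma Z5_cover (B : pred 'Z_5) :
    (forall i j, B i -> B j -> j - i \notin [:: 2%:R; 3%:R]) ->
  exists c, forall j, B j -> j - c \in [:: 0; 1].
Proof.
move=> indB; have [[i Bi]|nB] := pselect (exists i, B i); last first.
  by exists 0 => j Bj; case: nB; exists j.
exists (if B (i + 1) then i else i - 1) => j Bj.
have := indB _ _ Bi Bj; case: ifPn => Bi1.
  have := indB _ _ Bi1 Bj; rewrite opprD addrA.
  by case: (j - i) => [[|[|[|[|[|]]]]] //= ?].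
have : j - i != 1 by apply: contraNneq Bi1 => ji; rewrite addrC -ji subrK.
rewrite opprB addrCA [1 + _]addrC.
by case: (j - i) => [[|[|[|[|[|]]]]] //= ?].
Qed.

(** One coordinate suffices for adjacency, so both projections of [S] avoid the differences 2 and 3,
    and [Z5_cover] applies to each. *)
Lemma independent_sub_square (S : {set 'Z_5 * 'Z_5}) :
    {in S &, forall u v, ~~ G5 u v} -> exists c, S \subset square c.
Proof.
move=> indS.
have [c1 Hc1] : exists c, forall j, j \in [set u.1 | u in S]%SET -> j - c \in [:: 0; 1].
  apply: Z5_cover => _ _ /imsetP[u Su ->] /imsetP[v Sv ->].
  by have := indS _ _ Su Sv; rewrite negb_or => /andP[].
have [c2 Hc2] : exists c, forall j, j \in [set u.2 | u in S]%SET -> j - c \in [:: 0; 1].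
  apply: Z5_cover => _ _ /imsetP[u Su ->] /imsetP[v Sv ->].
  by have := indS _ _ Su Sv; rewrite negb_or => /andP[].
exists (c1, c2); apply/fintype.subsetP => u Su.
by rewrite in_square Hc1 ?Hc2 //; apply/imsetP; exists u.
Qed.

(** * Endomorphisms of $G_5$ close to the identity *)

Lemma Z5_const (T : Type) (g : 'Z_5 -> T) : (forall i, g (i + 1) = g i) ->
  forall i j, g i = g j.
Proof.
move=> g1; suff gn n : g n%:R = g 0 by move=> i j; rewrite -(natr_Zp i) -(natr_Zp j) !gn.
by elim: n => // n; rewrite -natr1 g1.
Qed.

(** Going round the cycle reverses the implication: four more steps [d] lead from [i + d] back to
    [i], because 5d = 0. *)
Lemma Z5_mono (g : 'Z_5 -> 'Z_5) (d : 'Z_5) :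
  (forall i, g i \in [:: 0; 1]) -> (forall i, g (i + d) = 1 -> g i = 1) ->
  forall i, g (i + d) = g i.
Proof.
move=> g01 gd i.
have gn n j : g (j + d *+ n) = 1 -> g j = 1.
  elim: n j => [|n IH] j; first by rewrite mulr0n addr0.
  by rewrite mulrS addrA => /IH/gd.
have g5 : g i = 1 -> g (i + d) = 1.
  move=> gi; apply: (gn 4%N); rewrite -addrA -mulrS.
  by rewrite -mulr_natr (_ : 5%:R = 0 :> 'Z_5) ?mulr0 ?addr0 //; apply/eqP.
have := g01 i; have := g01 (i + d); rewrite !inE => /orP[/eqP a|/eqP a] /orP[/eqP b|/eqP b].
- by rewrite a b.
- by have := g5 b; rewrite a b.
- by have := gd _ a; rewrite a b.
- by rewrite a b.
Qed.

(** [p] and [q] are the coordinates of the displacement from the corner [c u] to the vertex [u], and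
    the last hypothesis says that [c] preserves adjacency. Exchanging the axes gives the same for
    [q]. *)
Lemma corner_const (p q : 'Z_5 -> 'Z_5 -> 'Z_5) :
    (forall i j, p i j \in [:: 0; 1]) -> (forall i j, q i j \in [:: 0; 1]) ->
    (forall i j a b : 'Z_5,
       (a \in [:: 2%:R; 3%:R]) || (b \in [:: 2%:R; 3%:R]) ->
       (a + p i j - p (i + a) (j + b) \in [:: 2%:R; 3%:R]) ||
       (b + q i j - q (i + a) (j + b) \in [:: 2%:R; 3%:R])) ->
  forall i j i' j', p i j = p i' j'.
Proof.
move=> p01 q01 pq.
have pE i j : p i j = 0 \/ p i j = 1 by have := p01 i j; rewrite !inE => /orP[]/eqP->; [left|right].
have qE i j : q i j = 0 \/ q i j = 1 by have := q01 i j; rewrite !inE => /orP[]/eqP->; [left|right].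
(* Along the edge (2,0) the second alternative fails, as two values in {0,1} never differ by 2 or 3.
   The first says that [p i j - p (i + 2) j] is 0 or 1, which is the monotonicity [Z5_mono] asks
   for. *)
have row i j : p (i + 2%:R) j = p i j.
  apply: (@Z5_mono (p^~ j)) => // {}i.
  have := pq i j 2%:R 0 isT; rewrite addr0.
  by case: (pE (i + 2%:R) j) => ->; case: (pE i j) => ->;
    case: (qE (i + 2%:R) j) => ->; case: (qE i j) => ->.
have col i j : q i (j + 2%:R) = q i j.
  apply: (@Z5_mono (q i)) => // {}j.
  have := pq i j 0 2%:R isT; rewrite addr0.
  by case: (pE i (j + 2%:R)) => ->; case: (pE i j) => ->;
    case: (qE i (j + 2%:R)) => ->; case: (qE i j) => ->.
(* Two further steps of 2 lead from [i + 1] to [i] modulo 5. *)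
have row1 i j : p (i + 1) j = p i j.
  rewrite -[LHS](row _ j) -[LHS](row _ j) -!addrA; congr (p _ _).
  by rewrite -[RHS]addr0; congr (_ + _); apply/val_inj.
have col1 i j : q i (j + 1) = q i j.
  rewrite -[LHS](col i) -[LHS](col i) -!addrA; congr (q _ _).
  by rewrite -[RHS]addr0; congr (_ + _); apply/val_inj.
(* If [p] rose from 0 at [j] to 1 at [j + 1], the edge (2,1) at (i,j) would force [q] to be 1 at [i]
   and 0 at [i + 2], while the same edge at (i+2,j) would force [q] to be 1 at [i + 2]. *)
have pc i j : p i (j + 1) = p i j.
  apply: (@Z5_mono (p i)) => // {}j.
  have := pq i j 2%:R 1 isT; have := pq (i + 2%:R) j 2%:R 1 isT.
  rewrite !row !col1.
  by case: (pE i (j + 1)) => ->; case: (pE i j) => ->;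
    case: (qE i j) => ->; case: (qE (i + 2%:R) j) => ->; case: (qE (i + 2%:R + 2%:R) j) => ->.
move=> i j i' j'; rewrite (Z5_const _ (p i) (pc i) j j').
exact: (Z5_const _ (p^~ j') (row1^~ j')).
Qed.

Lemma hom_translation (c : 'Z_5 * 'Z_5 -> 'Z_5 * 'Z_5) :
    (forall u, u \in square (c u)) ->
    (forall u v, G5 u v -> G5 (c u) (c v)) ->
  forall u v, c u - u = c v - v.
Proof.
move=> c_sq c_hom; have c01 u : (u.1 - (c u).1 \in [:: 0; 1]) && (u.2 - (c u).2 \in [:: 0; 1]).
  by rewrite -in_square.
pose p i j := i - (c (i, j)).1; pose q i j := j - (c (i, j)).2.
have pq i j a b : (a \in [:: 2%:R; 3%:R]) || (b \in [:: 2%:R; 3%:R]) ->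
    (a + p i j - p (i + a) (j + b) \in [:: 2%:R; 3%:R]) ||
    (b + q i j - q (i + a) (j + b) \in [:: 2%:R; 3%:R]).
  have E (k m m' d : 'Z_5) : d + (k - m) - (k + d - m') = m' - m.
    by rewrite addrA [d + k]addrC opprB [LHS]addrC [LHS]addrA subrK.
  move=> ab; rewrite !E; apply: c_hom.
  by rewrite /G5 /= ![_ + _ - _]addrAC !subrr !add0r.
have pc := corner_const p q (fun i j => proj1 (andP (c01 (i, j))))
  (fun i j => proj2 (andP (c01 (i, j)))) pq.
have qc := corner_const (fun i j => q j i) (fun i j => p j i)
  (fun i j => proj2 (andP (c01 (j, i)))) (fun i j => proj1 (andP (c01 (j, i))))
  (fun i j a b ab => etrans (orbC _ _) (pq j i b a (etrans (orbC _ _) ab))).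
move=> [i j] [i' j']; apply: oppr_inj; rewrite !opprB.
by congr pair; [exact: pc | exact: qc].
Qed.

(** Each corner lies in the other square, so each coordinate difference and its opposite are both in
    {0,1}; modulo 5 this forces 0. *)
Lemma square_inj : injective square.
Proof.
move=> c c' cc'.
have in_self b : b \in square b by rewrite in_square !subrr.
have := in_self c; rewrite {1}cc' in_square; have := in_self c'; rewrite -{1}cc' in_square.
have E (i j : 'Z_5) : i - j \in [:: 0; 1] -> j - i \in [:: 0; 1] -> i = j.
  move=> + +; rewrite -(opprB i j) => ij ji; apply/eqP; rewrite -subr_eq0; move: ij ji.
  by case: (i - j) => [[|[|[|[|[|]]]]] //= ?].
case: c c' {cc'} => [i j] [i' j'] /= /andP[h1 h2] /andP[h3 h4].
by rewrite (E i i') // (E j j').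
Qed.

Lemma square_eq_shift c c' d : square c = square c' -> square (c + d) = square (c' + d).
Proof. by move=> /square_inj ->. Qed.

(** * Color classes along orbits of good colors *)

Section rigidity.
Context (M : zmodType) (A : set M) (f : 'Z_5 * 'Z_5 -> M).

(** This is S(x), over any abelian group. It is applied to the real line, with the periodic preimage
    of the base and real lifts of the translations. *)
Definition color_class (x : M) : {set 'Z_5 * 'Z_5} := [set u | `[< A (x - f u) >]]%SET.

Lemma in_color_class x u : (u \in color_class x) = `[< A (x - f u) >].
Proof. by rewrite inE. Qed.

Hypothesis color_class_indep : forall x, {in color_class x &, forall u v, ~~ G5 u v}.
(** [O] stands for the colors outside an exceptional null set, which keeps measure theory out of
    this section. *)
Context (O : set M).
Hypothesis O_shift : forall x u v, O x -> O (x + (f u - f v)).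
Hypothesis O_square : forall x, O x -> exists c, color_class x = square c.

(** With a = x - f(v) in [A], the corners [s w] of the squares S(a + f(w)) satisfy the hypotheses of
    [hom_translation]. Hence [s u - u = s v - v], where [s v = c]. *)
Lemma color_class_step x c v u : O x -> color_class x = square c -> v \in square c ->
  color_class (x + (f u - f v)) = square (c + (u - v)).
Proof.
move=> Ox xc vc; have Av : A (x - f v) by apply/asboolP; rewrite -in_color_class xc.
have [s sE] := choice (fun w => O_square _ (O_shift x w v Ox)).
have s_in w : w \in square (s w).
  by rewrite -sE in_color_class addrA addrAC addrK; apply/asboolP.
have s_hom w w' : G5 w w' -> G5 (s w) (s w').
  move=> ww'; apply: contraT => /square_meet[t].
  rewrite -!sE !in_color_class => /andP[/asboolP tw /asboolP tw'].
  have := color_class_indep (x - f v + f w + f w' - f t) w w'; rewrite ww' !in_color_class.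
  have -> : x - f v + f w + f w' - f t - f w = x + (f w' - f v) - f t.
    by rewrite addrAC [_ + f w + f w']addrAC addrK -!addrA [- f v + _]addrCA.
  have -> : x - f v + f w + f w' - f t - f w' = x + (f w - f v) - f t.
    by rewrite addrAC addrK -!addrA [- f v + _]addrCA.
  by move=> H; apply: H; exact/asboolP.
rewrite sE -(subrK u (s u)) (hom_translation s s_in s_hom u v) -addrA.
rewrite [- v + u]addrC; apply: square_eq_shift.
by rewrite -sE subrr addr0.
Qed.

(** [color_class_step] needs [v] in the current square, but [e] need not lie in [square c]. The
    detour moves the corner from [c] to 0, then to [- e], then to [c - e]. *)
Lemma color_class_sub x c e : e \in square 0 -> O x -> color_class x = square c ->
  O (x + (f 0 - f e)) /\ color_class (x + (f 0 - f e)) = square (c - e).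
Proof.
move=> e0 Ox xc; split; first exact: O_shift.
have self b : b \in square b by rewrite in_square !subrr.
have xc0 := color_class_step x c c 0 Ox xc (self c).
have Ox0 := O_shift x 0 c Ox.
rewrite sub0r subrr in xc0.
have xce := color_class_step _ _ e 0 Ox0 xc0 e0; rewrite !sub0r in xce.
have Oxe := O_shift _ 0 e Ox0.
have Nee : 0 \in square (- e).
  by move: e0; rewrite -(square_shift (- e)) subrr add0r.
(* Each of the three moves subtracts the translation at a vertex of the current square. *)
have -> : x + (f 0 - f e) = x + (f 0 - f c) + (f 0 - f e) + (f c - f 0).
  by rewrite [RHS]addrAC -[_ + (f c - f 0)]addrA subrKA subrr addr0.
by rewrite (color_class_step _ _ 0 c Oxe xce Nee) subr0 addrC.
Qed.

(** The shifted color is good, so it has some corner; [color_class_sub] leads back to [x] and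
    identifies that corner. *)
Lemma color_class_add x c e : e \in square 0 -> O x -> color_class x = square c ->
  O (x + (f e - f 0)) /\ color_class (x + (f e - f 0)) = square (c + e).
Proof.
move=> e0 Ox xc; have Oy := O_shift x e 0 Ox; split=> //.
have [c' yc'] := O_square _ Oy.
have [_] := color_class_sub _ _ _ e0 Oy yc'.
rewrite -addrA subrKA subrr addr0 xc yc' => /square_inj ->.
by rewrite subrK.
Qed.

Lemma color_class_subz x c e (n : int) : e \in square 0 -> O x -> color_class x = square c ->
  O (x + (f 0 - f e) *~ n) /\ color_class (x + (f 0 - f e) *~ n) = square (c - e *~ n).
Proof.
move=> e0 Ox xc; case: n => n.
  rewrite -!pmulrn; elim: n => [|n [On IH]]; first by rewrite !mulr0n subr0 addr0.
  have := color_class_sub _ _ e e0 On IH.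
  by rewrite -[_ + (f 0 - f e)]addrA -mulrSr -[_ - e]addrA -opprD -mulrSr.
rewrite !NegzE !mulrNz opprK -mulNrz opprB -!pmulrn.
elim: n.+1 => {n} [|n [On IH]]; first by rewrite !mulr0n !addr0.
have := color_class_add _ _ e e0 On IH.
by rewrite -[_ + (f e - f 0)]addrA -mulrSr -[_ + e]addrA -mulrSr.
Qed.

Lemma color_class_subz2 x c (a b : int) : O x -> color_class x = square c ->
  color_class (x + (f 0 - f (1, 0)) *~ a + (f 0 - f (0, 1)) *~ b) =
  square (c - (a%:~R, b%:~R)).
Proof.
move=> Ox xc.
have e1 : (1, 0) \in square 0 by rewrite in_square.
have e2 : (0, 1) \in square 0 by rewrite in_square.
have [Oy yc] := color_class_subz x c (1, 0) a e1 Ox xc.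
have [_ ->] := color_class_subz _ _ (0, 1) b e2 Oy yc.
congr square; rewrite -addrA -opprD; congr (_ - _).
have pairz (u : 'Z_5 * 'Z_5) n : u *~ n = (u.1 *~ n, u.2 *~ n).
  by rewrite (surjective_pairing (u *~ n)) !(raddfMz fst, raddfMz snd).
rewrite !pairz /= !mul0rz; congr pair; [exact: addr0 | exact: add0r].
Qed.

End rigidity.

(** * Simultaneous Diophantine approximation *)

Lemma dirichlet2 (R : realType) (x y : R) (k : nat) : exists n (p q : int),
  [/\ (0 < n)%N, `|n%:R * x - p%:~R| < k.+1%:R^-1 & `|n%:R * y - q%:~R| < k.+1%:R^-1].
Proof.
pose frac (z : R) := z - (Num.floor z)%:~R.
(* [inord] never takes its default value: [frac z < 1] keeps the index below [k.+1]. *)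
pose box z : 'I_k.+1 := inord (Num.truncn (k.+1%:R * frac z)).
have frac01 z : 0 <= frac z < 1.
  by rewrite /frac subr_ge0 floor_le ltrBlDl -[ltRHS]intrD1 floorD1_gt.
have box_close w z : box w = box z -> `|frac w - frac z| < k.+1%:R^-1.
  have kfrac v : 0 <= k.+1%:R * frac v.
    by case/andP: (frac01 v) => v0 _; exact: mulr_ge0.
  have bE v : box v = Num.truncn (k.+1%:R * frac v) :> nat.
    rewrite /box inordK // truncn_lt_nat //.
    by case/andP: (frac01 v) => _ v1; rewrite gtr_pMr.
  move=> /(congr1 val) /=; rewrite !bE => wz.
  have /andP[w1 w2] := truncn_itv (kfrac w).
  have /andP[z1 z2] := truncn_itv (kfrac z).
  rewrite -wz in z1 z2; move: (Num.truncn _) w1 w2 z1 z2 => t.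
  rewrite -[t.+1%:R]natr1 => w1 w2 z1 z2.
  have k0 : 0 < k.+1%:R :> R by [].
  rewrite -[_^-1]mulr1 ltr_pdivlMl // -{1}(gtr0_norm k0) -normrM mulrBr.
  by rewrite ltr_norml; apply/andP; split; lra.
(* Pigeonhole: (k+1)^2 + 1 multiples of (x, y) fall into (k+1)^2 boxes of side 1/(k+1). *)
pose g (i : 'I_(k.+1 * k.+1).+1) := (box (i%:R * x), box (i%:R * y)).
have /injectivePn[i [j + gij]] : ~~ injectiveb g.
  apply/injectiveP => /leq_card; rewrite card_prod !card_ord; by rewrite ltnn.
wlog ij : i j gij / (i < j)%N => [H ij|_].
  case: (ltngtP i j) => [lt|lt|/val_inj eq]; last by rewrite eq eqxx in ij.
    exact: (H i j).
  by apply: (H j i) => //; rewrite eq_sym.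
case: gij => /box_close Hx /box_close Hy.
move: (nat_of_ord i) (nat_of_ord j) ij Hx Hy => {g j} {}i j ij Hx Hy.
exists (j - i)%N, (Num.floor (j%:R * x) - Num.floor (i%:R * x)),
  (Num.floor (j%:R * y) - Num.floor (i%:R * y)).
have E (z : R) : (j - i)%:R * z - (Num.floor (j%:R * z) - Num.floor (i%:R * z))%:~R
    = - (frac (i%:R * z) - frac (j%:R * z)).
  rewrite /frac (natrB _ (ltnW ij)) intrB mulrBl; set a := j%:R * z; set b := i%:R * z.
  by rewrite !opprB addrACA [- b - _]addrC addrACA.
by rewrite subn_gt0 !E !normrN.
Qed.

(** Coprimality is recorded as a Bezout identity because that form survives reduction modulo 5. *)
Lemma small_bezout_combination (R : realType) (x y e : R) : 0 < e ->
  exists a b u v : int, u * a + v * b = 1 /\ `|a%:~R * x + b%:~R * y| < e.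
Proof.
(* The final error is at most d(|p| + |q|)/n, and |p| + |q| is at most n|x| + n|y| + 2, hence at
   most nC. *)
move=> e0; pose C := `|x| + `|y| + 2.
have C0 : 0 < C by rewrite /C; have := normr_ge0 x; have := normr_ge0 y; lra.
pose k := Num.truncn (C / e).
have ke : k.+1%:R^-1 * C < e.
  rewrite mulrC ltr_pdivrMr // -ltr_pdivrMl // mulrC.
  by have /andP[] := truncn_itv (ltW (divr_gt0 C0 e0)).
(* If n x, n y are within d of p, q, then (q, -p) / gcd(p, q) is the combination. *)
have [n [p [q [n0 Hp Hq]]]] := dirichlet2 _ x y k.
set d := _^-1 in ke Hp Hq.
have d1 : d <= 1 by rewrite invf_le1 // ler1n.
have n1 : 1 <= n%:R :> R by rewrite ler1n.
have d0 : 0 < d by rewrite invr_gt0.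
(* If p = q = 0 there is nothing to divide, but then [x] itself is already small and (1, 0)
   serves. *)
have [/eqP|g0] := eqVneq (gcdz p q) 0.
  rewrite gcdz_eq0 => /andP[/eqP p0 _]; exists 1, 0, 1, 0; split; first by rewrite mulr0 addr0.
  rewrite mul1r mul0r addr0; move: Hp; rewrite p0 subr0 normrM ger0_norm // => Hp.
  apply: le_lt_trans ke; apply: (@le_trans _ _ (n%:R * `|x|)).
    by rewrite ler_peMl.
  apply/(le_trans (ltW Hp)); rewrite ler_peMr ?ltW // /C.
  by have := normr_ge0 x; have := normr_ge0 y; lra.
have [u [v uv]] := Bezoutz p q.
have /dvdzP[p' p'E] := dvdz_gcdl p q; have /dvdzP[q' q'E] := dvdz_gcdr p q.
exists q', (- p'), v, (- u); split.
  by apply: (mulIf g0); rewrite mulrDl mul1r mulrNN -!mulrA -p'E -q'E addrC.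
have g1 : 1 <= `|(gcdz p q)%:~R| :> R.
  by rewrite -intr_norm -[1]/(1%:~R) ler_int -gtz0_ge1 normr_gt0.
rewrite mulrNz mulNr.
apply: le_lt_trans ke.
set t := q'%:~R * x - p'%:~R * y.
have n_gt0 : 0 < n%:R :> R by rewrite ltr0n.
rewrite -(ler_pM2l n_gt0).
pose A := n%:R * x - p%:~R; pose B := n%:R * y - q%:~R.
have ngt : n%:R * (gcdz p q)%:~R * t = q%:~R * A - p%:~R * B.
  have pR : p%:~R = p'%:~R * (gcdz p q)%:~R :> R by rewrite -intrM -p'E.
  have qR : q%:~R = q'%:~R * (gcdz p q)%:~R :> R by rewrite -intrM -q'E.
  by rewrite /t /A /B pR qR; ring.
have px : `|p%:~R| <= n%:R * `|x| + 1 :> R.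
  have -> : p%:~R = n%:R * x - A by rewrite /A; ring.
  apply: (le_trans (ler_normB _ _)); rewrite normrM ger0_norm // lerD2l.
  exact: le_trans (ltW Hp) d1.
have qy : `|q%:~R| <= n%:R * `|y| + 1 :> R.
  have -> : q%:~R = n%:R * y - B by rewrite /B; ring.
  apply: (le_trans (ler_normB _ _)); rewrite normrM ger0_norm // lerD2l.
  exact: le_trans (ltW Hq) d1.
apply: (@le_trans _ _ `|n%:R * (gcdz p q)%:~R * t|).
  by rewrite !normrM [`|n%:R|]ger0_norm // -mulrA ler_pM2l // ler_peMl.
rewrite ngt; apply: (le_trans (ler_normB _ _)); rewrite !normrM.
apply: (@le_trans _ _ (`|q%:~R| * d + `|p%:~R| * d)).
  by apply: lerD; apply: ler_wpM2l => //; exact: ltW.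
rewrite -mulrDl mulrCA [d * _]mulrC ler_wpM2r ?(ltW d0) //.
rewrite /C; move: (normr_ge0 x) (normr_ge0 y) => x0 y0.
by rewrite !mulrDr; lra.
Qed.

(** * Lebesgue measure: translates, Steinhaus' theorem and null sets *)

Lemma measurable_fun_shift (R : realType) (t : R) :
  measurable_fun [set: measurableTypeR R]
    (fun x : measurableTypeR R => x + t : measurableTypeR R).
Proof. exact: measurable_funD. Qed.

Lemma measurable_shift (R : realType) (t : R) (A : set R) : measurable A ->
  measurable [set x | A (x + t)].
Proof.
move=> mA; rewrite -[X in measurable X]setTI.
exact: (measurable_fun_shift _ t measurableT A mA).
Qed.

Lemma lebesgue_measure_shift (R : realType) (t : R) (A : set R) : measurable A ->
  lebesgue_measure [set x | A (x + t)] = lebesgue_measure A.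
Proof.
move=> mA; pose m : {measure set (measurableTypeR R) -> \bar R} :=
  measure_function_pushforward__canonical__measure_function_Measure lebesgue_measure
    (measurable_fun_shift _ t).
apply/esym/(@lebesgue_measure_unique R m) => // _ [[a b]] _ <-.
rewrite /m /= /pushforward (_ : _ @^-1` _ = `](a - t), (b - t)]%classic); last first.
  by apply/seteqP; split=> x /=; rewrite !in_itv /= ltrBlDr lerBrDr.
rewrite !lebesgue_measure_itv /= !lte_fin ltrD2r.
by case: ifP => // _; rewrite -!EFinD opprB addrA subrK.
Qed.

(** Take a compact K in [E] of positive measure and an open U around K with U \ K of smaller measure
    than K. For small t the translate K + t stays in U; if it missed K, it would fit into U \ K. *)
Lemma steinhaus (R : realType) (E : set R) : measurable E ->
  (0 < lebesgue_measure E)%E ->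
  exists2 e : R, 0 < e & forall t, `|t| < e -> exists2 x, E x & E (x + t).
Proof.
move=> mE; rewrite (lebesgue_regularity_inner_sup mE) => /ereal_sup_gt.
move=> [_ [K [cK KE] <-] K0]; have mK := compact_measurable cK.
have Kfin := compact_finite_measure cK.
have fK : lebesgue_measure K \is a fin_num by rewrite ge0_fin_numE.
have r0 : 0 < fine (lebesgue_measure K) by rewrite fine_gt0 // K0.
have [U [oU KU UK]] := lebesgue_regularity_outer mK Kfin r0.
have /compact_near_coveringP/(_ R (nbhs (0 : R)) (fun t x => U (x + t))) := cK.
case=> [x Kx|e /= e0 eU].
  apply: (@add_continuous R (x, 0) U).
  by rewrite /= addr0; apply: open_nbhs_nbhs; split => //; exact: KU.
exists e => // t te; apply: contrapT => nE.
have : (lebesgue_measure [set x | K (x - t)%R] <= lebesgue_measure (U `\` K))%E.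
  apply: le_measure; rewrite ?inE.
  - exact: measurable_shift.
  - by apply: measurableD => //; exact: open_measurable.
  move=> x /= Kxt; split; last first.
    by move=> Kx; apply: nE; exists (x - t); [exact: KE | rewrite subrK; exact: KE].
  rewrite -(subrK t x); apply: eU => //.
  by rewrite /= sub0r normrN.
by rewrite lebesgue_measure_shift // leNgt -[ltRHS]fineK // UK.
Qed.

Lemma negligible_bigcup_countable d (T : measurableType d) (R : realType)
    (mu : {measure set T -> \bar R}) (J : countType) (F : J -> set T) :
  (forall j, mu.-negligible (F j)) -> mu.-negligible (\bigcup_j F j).
Proof.
move=> F0; apply: (@negligibleS _ _ _ mu
    (\bigcup_n (if @unpickle J n is Some j then F j else set0))).
  by move=> x [j _ Fjx]; exists (pickle j) => //; rewrite pickleK.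
by apply: negligible_bigcup => n; case: unpickle => // ; exact: negligible_set0.
Qed.

(** Integrating the pointwise bound over [D] gives k mu(D) + mu(B n D) <= k mu(D), and the finite
    term cancels. *)
Lemma negligible_deficient d (T : measurableType d) (R : realType)
    (mu : {measure set T -> \bar R}) (J : finType) (X : J -> set T)
    (D B : set T) (k : R) :
    measurable D -> (mu D < +oo)%E -> (forall j, measurable (X j)) -> measurable B ->
    (forall x, D x -> \sum_j \1_(X j) x + \1_B x <= k) ->
    (\sum_j mu (X j `&` D) = k%:E * mu D)%E ->
  mu (B `&` D) = 0%E.
Proof.
move=> mD Dfin mX mB le_k sum_k.
have mind (Y : set T) : measurable Y -> measurable_fun D (fun x => (\1_Y x)%:E : \bar R).
  by move=> mY; apply/measurable_EFinP; exact: measurable_indic.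
have : (\int[mu]_(x in D) (\sum_j (\1_(X j) x)%:E + (\1_B x)%:E) <=
    \int[mu]_(x in D) (cst k%:E) x)%E.
  apply: ge0_le_integral => //.
  - by move=> x _; apply: adde_ge0 => //; apply: sume_ge0 => j _; rewrite lee_fin.
  - by apply: emeasurable_funD; [apply: emeasurable_sum => j; exact: mind|exact: mind].
  - by move=> x Dx; rewrite sumEFin -EFinD lee_fin le_k.
rewrite integral_cst // ge0_integralD //; first last.
- exact: mind.
- by apply: emeasurable_sum => j; exact: mind.
- by move=> x _; apply: sume_ge0 => j _; rewrite lee_fin.
have mindX j : measurable_fun D (fun x => (\1_(X j) x)%:E : \bar R) by exact: mind.
rewrite (ge0_integral_sum mu mD mindX) //.
rewrite (eq_bigr (fun j => mu (X j `&` D))) => [|j _]; last by rewrite integral_indic.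
rewrite sum_k integral_indic // => le0.
apply/eqP; rewrite -measure_le0.
have kfin : (k%:E * mu D)%E \is a fin_num.
  by rewrite fin_numM // ge0_fin_numE.
by rewrite -(leeD2lE _ _ kfin) adde0.
Qed.

Lemma measurable_color_class (R : realType) (P : set R) (f : 'Z_5 * 'Z_5 -> R) S :
  measurable P -> measurable [set x | color_class _ P f x = S].
Proof.
move=> mP; rewrite (_ : mkset _ = \bigcap_u
    (if u \in S then [set x | P (x - f u)] else ~` [set x | P (x - f u)])); last first.
  apply/seteqP; split=> x /=.
    by move=> xS u _; rewrite -xS in_color_class; case: asboolP.
  move=> xS; apply/finset.setP => u; rewrite in_color_class; have := xS u I.
  by case: (u \in S) => /= ?; [exact/asboolP | exact/asboolP].
apply: fin_bigcap_measurable => [|u _]; first exact: finite_finset.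
have mu := measurable_shift _ (- f u) _ mP.
by case: ifP => // _; exact: measurableC.
Qed.

Lemma negligible_shift (R : realType) (t : R) (A : set R) : measurable A ->
  (@lebesgue_measure R).-negligible A ->
  (@lebesgue_measure R).-negligible [set x | A (x + t)].
Proof.
move=> mA nA; have A0 : lebesgue_measure A = 0%E by apply/negligibleP.
apply/negligibleP; first exact: measurable_shift.
exact: etrans (lebesgue_measure_shift _ t _ mA) A0.
Qed.

(** The integer translates of the part of [B] in [0, 1[ cover [B]. *)
Lemma negligible_periodic (R : realType) (B : set R) : measurable B ->
    (forall x, B (x + 1) <-> B x) -> lebesgue_measure (B `&` `[0, 1[) = 0%E ->
  (@lebesgue_measure R).-negligible B.
Proof.
move=> mB B1 B0.
have Bz (n : int) x : B (x + n%:~R) <-> B x.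
  case: n => n; elim: n x => [|n IH] x.
  - by rewrite addr0.
  - by rewrite -addn1 PoszD intrD addrA B1.
  - by rewrite NegzE rmorphN -(B1 (x - _)) subrK.
  - by rewrite -(IH x) -(B1 (x + _)) -addrA !NegzE -[n.+2]addn1 PoszD opprD intrD subrK.
pose F (n : int) := [set x | (B `&` `[0, 1[) (x - n%:~R)].
suff : (@lebesgue_measure R).-negligible (\bigcup_n F n).
  apply: negligibleS => x Bx; exists (Num.floor x) => //; split.
    by rewrite /= -intrN Bz.
  by rewrite /= in_itv /= subr_ge0 floor_le ltrBlDl -[ltRHS]intrD1 floorD1_gt.
apply: negligible_bigcup_countable => n.
have mB01 : measurable (B `&` `[0, 1[) by apply: measurableI => //; exact: measurable_itv.
by apply: negligible_shift => //; apply/negligibleP.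
Qed.

(** * The contradiction, on the real line *)

Theorem theorem20 (R : realType) :
  ~ exists A : set (circle R),
      [/\ measurable A, coloring_base G5 A & haar A = (4%:R / 25%:R)%:E].
Proof.
move=> [A [mA [f f_adj] hA]].
(* Everything is lifted to the reals, where [small_bezout_combination] and [steinhaus] apply; [P] is
   1-periodic. *)
pose F u : R := repr (f u).
have piF u : circle_pi (F u) = f u :> circle R by exact: reprK.
pose P : set R := @circle_pi R @^-1` A.
have mP : measurable P.
  by rewrite -[P]setTI; exact: (measurable_circle_pi measurableT mA).
pose col x := color_class _ P F x.
have in_col x u : u \in col x -> [set a + f u | a in A] (circle_pi x).
  rewrite in_color_class => /asboolP Px; exists (circle_pi (x - F u)) => //.
  by rewrite -piF -circle_piD subrK.
have indep x : {in col x &, forall u v, ~~ G5 u v}.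
  move=> u v /in_col xu /in_col xv; apply/negP => /f_adj /seteqP[sub0 _].
  by apply: (sub0 (circle_pi x)).
have le4 x : (#|col x| <= 4)%N.
  have [c /subset_leq_card] := independent_sub_square _ (indep x).
  by rewrite card_square.
have squareP x : #|col x| = 4%N -> exists c, col x = square c.
  move=> x4; have [c sub] := independent_sub_square _ (indep x); exists c.
  by apply/eqP; rewrite eqEcard sub card_square x4.
pose B := [set x | #|col x| != 4%N].
have mB : measurable B.
  have -> : B = \bigcup_(S in [set S : {set 'Z_5 * 'Z_5} | #|S| != 4%N]) [set x | col x = S].
    by apply/seteqP; split=> [x xB|x [S S4 xS]]; [exists (col x) | rewrite /B /= xS].
  by apply: fin_bigcup_measurable => // S _; exact: measurable_color_class.
have mX u : measurable [set x | P (x - F u)] by exact: measurable_shift.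
have muX u : lebesgue_measure ([set x | P (x - F u)] `&` `[0, 1[) = (4%:R / 25%:R)%:E.
  rewrite -hA -(haar_translation (f u) mA) /haar /pushforward /mrestr.
  congr (lebesgue_measure (_ `&` _)); apply/seteqP; split=> x /=.
    by move=> Px; apply: in_col; rewrite in_color_class; exact/asboolP.
  move=> [a Aa ax]; rewrite /P /= (_ : circle_pi (x - F u) = a) //.
  by apply: (addIr (f u)); rewrite ax -piF -circle_piD subrK.
have I1 : lebesgue_measure (`[0%R, 1%R[%classic : set R) = 1%:E.
  by rewrite lebesgue_measure_itv /= lte_fin ltr01 -EFinD subr0.
(* No color has more than 4 vertices in its class, while the average over a period is 25 * 4/25 =
   4. *)
have B01 : lebesgue_measure (B `&` `[0, 1[) = 0%E.
  apply: (@negligible_deficient _ (measurableTypeR R) R (@lebesgue_measure R) _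
    (fun u => [set x | P (x - F u)]) `[0, 1[%classic B 4%:R) => //.
  - by rewrite [X in (X < _)%E]I1 ltry.
  - move=> x _; rewrite (_ : \sum_j _ = #|col x|%:R); last first.
      rewrite -sum1_card natr_sum [RHS]big_mkcond /=; apply: eq_bigr => u _.
      by rewrite indicE in_color_class; case: asboolP => Px; [rewrite mem_set | rewrite memNset].
    rewrite indicE -natrD ler_nat; have := le4 x; rewrite leq_eqVlt.
    case/predU1P => [x4|x4]; last first.
      by rewrite -addn1 in x4; apply: leq_trans x4; rewrite leq_add2l leq_b1.
    by rewrite memNset ?x4 // /B /= x4 eqxx.
  rewrite [X in (_ * X)%E]I1 -EFinM.
  rewrite (eq_bigr _ (fun u _ => muX u)) (sumEFin _ _ (fun=> 4%:R / 25%:R)).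
  rewrite sumr_const card_prod !card_ord.
  by rewrite -mulr_natr (_ : (_ * _)%N = 25%N) //; congr EFin; field.
have Bnull : (@lebesgue_measure R).-negligible B.
  apply: negligible_periodic => // x.
  rewrite /B /= (_ : col (x + 1) = col x) //; apply/finset.setP => u; rewrite !in_color_class.
  congr asbool; rewrite /P /= (_ : circle_pi (x + 1 - F u) = circle_pi (x - F u)) //.
  by apply/circle_pi_eq; rewrite [x + 1 - _]addrAC [_ + 1]addrC addrK int_num1.
have Ncol s : (@lebesgue_measure R).-negligible
    [set x | B (x + \sum_(uv <- s) (F uv.1 - F uv.2))].
  exact: negligible_shift.
have [N [mN N0 subN]] := negligible_bigcup_countable _ _ _ _ _ _ Ncol.
(* The good orbits: sums over sequences of pairs exhaust the group generated by
   the differences [F u - F v], which is countable. *)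
pose O := ~` (\bigcup_s [set x | B (x + \sum_(uv <- s) (F uv.1 - F uv.2))]).
have O_shift x u v : O x -> O (x + (F u - F v)).
  move=> Ox [s _ /= xs]; apply: Ox; exists ((u, v) :: s) => //=.
  by rewrite big_cons addrA.
have O_square x : O x -> exists c, col x = square c.
  move=> Ox; apply: squareP; apply/eqP; apply: contrapT => /negP x4; apply: Ox.
  by exists [::] => //=; rewrite big_nil addr0.
(* Finitely many squares occur, and together with the null set [N] their level sets cover the line,
   so one level set is not null. *)
have [c Wc] : exists c, ~ (@lebesgue_measure R).-negligible [set x | col x = square c].
  apply: contrapT => noW.
  have : (@lebesgue_measure R).-negligible (N `|` \bigcup_c [set x | col x = square c]).
    apply: negligibleU; first by apply/negligibleP.
    apply: negligible_bigcup_countable => c; apply: contrapT => Wc; apply: noW.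
    by exists c.
  rewrite (_ : _ `|` _ = setT); last first.
    apply/seteqP; split=> // x _; have [Ox|nOx] := pselect (O x).
      by have [c xc] := O_square _ Ox; right; exists c.
    by left; apply: subN; apply: contrapT.
  move=> nT; have : lebesgue_measure (`[0%R, 1%R[%classic : set R) = 0%E.
    by apply/negligibleP; [exact: measurable_itv | exact: negligibleS nT].
  by rewrite I1 => -[] /eqP; rewrite oner_eq0.
(* Removing the measurable null set [N], which contains all bad colors, keeps [E] measurable and
   inside [O]. *)
pose E := [set x | col x = square c] `\` N.
have mE : measurable E by apply: measurableD => //; exact: measurable_color_class.
have [|e e0 He] := steinhaus _ _ mE.
  rewrite lt0e measure_ge0 andbT; apply/eqP => E0; apply: Wc.
  have : (@lebesgue_measure R).-negligible (E `|` N).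
    by apply: negligibleU; apply/negligibleP.
  by apply: negligibleS => x xc; have [xN|xN] := pselect (N x); [right | left].
have [a [b [u [v [uv ab]]]]] :=
  small_bezout_combination _ (F 0 - F (1, 0)) (F 0 - F (0, 1)) _ e0.
have [x [xc xN] [xtc _]] := He _ ab.
have Ox : O x by move=> xO; apply: xN; exact: subN.
have := color_class_subz2 _ P F indep O O_shift O_square _ _ a b Ox xc.
rewrite -addrA -[X in _ + (X + _)]mulrzl -[X in _ + (_ + X)]mulrzl.
rewrite -/(col _) xtc => /square_inj /esym/eqP.
rewrite addrC -subr_eq0 addrK oppr_eq0 => /eqP [a0 b0].
(* Both colors have the corner [c], so [a] and [b] vanish modulo 5, and the Bezout identity becomes
   0 = 1 there. *)
have /eqP : (u * a + v * b)%:~R = 1 :> 'Z_5 by rewrite uv.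
by rewrite intrD !intrM a0 b0 !mulr0.
Qed.
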